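(* For an arbitrary point $w\in S$, the vector $\psi(w)$ (defined, as in the context, by $\psi(w)_l=\sigma_lw_l$ with $\sigma_l=\sqrt{1+2\mu+2l\lambda}$ and the two constraints) is given by $$\psi(w)_l=\sqrt{\frac{w^T\Gamma^2w-(M+l)\,w^T\Gamma w+Ml\,w^Tw}{(w^Tw)(w^T\Gamma^2w)-(w^T\Gamma w)^2}}\;w_l,\qquad l=F,\dots,-F.$$
   Context: Let $F\ge 1$ be an integer, $n$ a positive even integer, $N=2n(2F+1)$, and let $M$ be a real number with $0\le M<F$ and $M\notin\mathbb{Z}$. Vectors $w\in\mathbb{R}^N$ are written in blocks $w=(w_F;w_{F-1};\dots;w_{-F})$ with $w_l\in\mathbb{R}^{2n}$, the index $l$ ranging over the integers from $-F$ to $F$. Let $\Gamma=\mathrm{diag}(F I_{2n},(F-1)I_{2n},\dots,I_{2n},0,-I_{2n},\dots,-F I_{2n})\in\mathbb{R}^{N\times N}$, so $(\Gamma w)_l=l\,w_l$. Let $$S=\{w\in\mathbb{R}^N : w^T\Gamma^2w-(M+l)\,w^T\Gamma w+Ml\,w^Tw>0\ \text{ for } l=F \text{ and } l=-F\}.$$ For $w\in S$, $\psi(w)\in\mathbb{R}^N$ is defined by $\psi(w)_l=\sigma_l w_l$ with positive coefficients of the form $$\sigma_l=\sqrt{1+2\mu+2l\lambda},\qquad l=F,\dots,-F,$$ where the real numbers $\mu,\lambda$ (depending on $w$) are determined by the constraints $$\sum_{l=-F}^F\|w_l\|_2^2\sigma_l^2=1,\qquad \sum_{l=-F}^F l\,\|w_l\|_2^2\sigma_l^2=M.$$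 *)

(* Defs.v *)
From HB Require Import structures.
From mathcomp Require Import all_boot all_order all_algebra.
From mathcomp Require Import all_classical all_reals.

Set Implicit Arguments.
Unset Strict Implicit.
Unset Printing Implicit Defensive.

Import Order.TTheory GRing.Theory Num.Theory.
Local Open Scope classical_set_scope.
Local Open Scope ring_scope.

(* R^N is presented through the library's block columns: there are 2F+1 blocks
   of size 2n, and [submxcol w k] is the k-th block.  The blocks are listed from
   the top (k = 0) in the order l = F, F-1, ..., -F; see [level]. *)
Notation bdim F n := (\sum_(k < 2 * F + 1) (2 * n))%N.
Notation bvec R F n := 'cV[R]_(bdim F n).

Lemma bdimE (F n : nat) : bdim F n = (2 * n * (2 * F + 1))%N.
Proof. by rewrite sum_nat_const card_ord mulnC. Qed.

Definition level (F : nat) (k : 'I_(2 * F + 1)) : int := F%:Z - (k : nat)%:Z.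

Definition block (R : realType) (F n : nat) (w : bvec R F n)
    (k : 'I_(2 * F + 1)) : 'cV[R]_(2 * n) :=
  @submxcol R _ (fun _ : 'I_(2 * F + 1) => (2 * n)%N) 1 w k.

Definition Gamma (R : realType) (F n : nat) : 'M[R]_(bdim F n) :=
  \mxdiag_(k < 2 * F + 1) (((level k)%:~R)%:M : 'M[R]_(2 * n)).

Lemma block_Gamma (R : realType) (F n : nat) (w : bvec R F n)
    (k : 'I_(2 * F + 1)) :
  block (Gamma R F n *m w) k = (level k)%:~R *: block w k.
Proof.
rewrite /block /Gamma -[in LHS](submxcolK w) mul_mxdiag_mxcol mxcolK.
by rewrite mul_scalar_mx.
Qed.

(* The norm `|v| on matrices in MathComp-Analysis is the sup norm. *)
Definition norm2 (R : realType) (m : nat) (v : 'cV[R]_m) : R :=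
  Num.sqrt (\sum_(i < m) v i ord0 ^+ 2).

Definition qform (R : realType) (m : nat) (A : 'M[R]_m) (w : 'cV[R]_m) : R :=
  (w^T *m A *m w) ord0 ord0.

Definition dotself (R : realType) (m : nat) (w : 'cV[R]_m) : R :=
  (w^T *m w) ord0 ord0.

Definition S_set (R : realType) (F n : nat) (M : R) : set (bvec R F n) :=
  [set w | forall l : int, l = F%:Z \/ l = - F%:Z ->
     0 < qform (Gamma R F n ^+ 2) w - (M + l%:~R) * qform (Gamma R F n) w
         + M * l%:~R * dotself w].
Arguments S_set {R} F n M.

Definition sigma (R : realType) (mu lambda : R) (l : int) : R :=
  Num.sqrt (1 + 2 * mu + 2 * l%:~R * lambda).

(* Since [Num.sqrt] vanishes on nonpositive arguments, positivity of the
   coefficients forces the expressions under the roots to be positive. *)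
Definition is_multiplier (R : realType) (F n : nat) (M : R) (w : bvec R F n)
    (p : R * R) : Prop :=
  [/\ forall k : 'I_(2 * F + 1), 0 < sigma p.1 p.2 (level k),
      \sum_(k < 2 * F + 1)
        norm2 (block w k) ^+ 2 * sigma p.1 p.2 (level k) ^+ 2 = 1
    & \sum_(k < 2 * F + 1)
        (level k)%:~R * norm2 (block w k) ^+ 2
          * sigma p.1 p.2 (level k) ^+ 2 = M].

(* (mu, lambda) is a pair meeting the constraints; (0, 0) is an arbitrary value
   used when there is none. *)
Definition multiplier (R : realType) (F n : nat) (M : R) (w : bvec R F n) :
    R * R :=
  xget (0, 0) [set p | is_multiplier M w p].

Definition psi (R : realType) (F n : nat) (M : R) (w : bvec R F n) :
    bvec R F n :=
  \mxcol_(k < 2 * F + 1)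
    (sigma (multiplier M w).1 (multiplier M w).2 (level k) *: block w k).

(* Main.v *)
Require Import Defs.
From mathcomp Require Import all_boot all_order all_algebra.
From mathcomp Require Import all_classical all_reals.
From mathcomp Require Import ring lra.

(** Both constraints see [w] only through the moments
    a = w^T w, b = w^T Gamma w and c = w^T Gamma^2 w, which are the sums over
    the levels l of |w_l|^2, l |w_l|^2 and l^2 |w_l|^2.  With s = 1 + 2 mu and
    t = 2 lambda, so that sigma_l^2 = s + l t, the constraints are the linear
    system a s + b t = 1, b s + c t = M.  Its determinant is D = a c - b^2, and
    Cramer's rule gives s + l t = g(l) / D with
    g(l) = c - (M + l) b + M l a, which is the announced formula.

    It remains to see that D > 0 and that g > 0 at every level, so that the
    roots are roots of positive numbers.  The function g is affine in l, hence
    positive on [-F, F] once it is positive at both ends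
    ([affine_gt0_between]).  For D, note that
    a g(l) = D + (b - M a) (b - l a).  If D were nonpositive, the product
    (b - M a) (b - l a) would be positive for l = F and l = -F; but
    -F a <= b <= F a makes b - l a change sign between these two values
    ([moment_det_gt0]). *)

Set Implicit Arguments.
Unset Strict Implicit.
Unset Printing Implicit Defensive.

Import Order.TTheory GRing.Theory Num.Theory.
Local Open Scope classical_set_scope.
Local Open Scope ring_scope.

Lemma norm2_sqr (R : realType) (m : nat) (v : 'cV[R]_m) :
  norm2 v ^+ 2 = \sum_(i < m) v i ord0 ^+ 2.
Proof. by rewrite /norm2 sqr_sqrtr // sumr_ge0 // => i _; exact: sqr_ge0. Qed.

Lemma level_bound (R : realType) (F : nat) (k : 'I_(2 * F + 1)) :
  - F%:R <= (level k)%:~R :> R /\ (level k)%:~R <= F%:R :> R.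
Proof.
have hk : (k : nat)%:R <= (2 * F)%:R :> R.
  by rewrite ler_nat -ltnS -(addn1 (2 * F)) ltn_ord.
have hk0 : 0 <= (k : nat)%:R :> R by exact: ler0n.
rewrite natrM in hk.
by rewrite /level rmorphB /= -!pmulrn; split; lra.
Qed.

Lemma dot_blocks (R : realType) (F n : nat) (u v : bvec R F n) :
  (u^T *m v) ord0 ord0 =
    \sum_(k < 2 * F + 1) \sum_i block u k i ord0 * block v k i ord0.
Proof.
rewrite /block -[in LHS](submxcolK u) -[in LHS](submxcolK v).
rewrite tr_mxcol mul_mxrow_mxcol summxE; apply: eq_bigr => k _.
by rewrite !mxE; apply: eq_bigr => i _; rewrite !mxE.
Qed.

Lemma dotself_moment (R : realType) (F n : nat) (w : bvec R F n) :
  dotself w = \sum_(k < 2 * F + 1) norm2 (block w k) ^+ 2.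
Proof.
rewrite /dotself dot_blocks; apply: eq_bigr => k _.
by rewrite norm2_sqr; apply: eq_bigr => i _; rewrite expr2.
Qed.

Lemma qform_Gamma_moment (R : realType) (F n : nat) (w : bvec R F n) :
  qform (Gamma R F n) w =
    \sum_(k < 2 * F + 1) (level k)%:~R * norm2 (block w k) ^+ 2.
Proof.
rewrite /qform -mulmxA dot_blocks; apply: eq_bigr => k _.
rewrite norm2_sqr mulr_sumr block_Gamma.
by apply: eq_bigr => i _; rewrite !mxE; ring.
Qed.

Lemma qform_Gamma2_moment (R : realType) (F n : nat) (w : bvec R F n) :
  qform (Gamma R F n ^+ 2) w =
    \sum_(k < 2 * F + 1) (level k)%:~R ^+ 2 * norm2 (block w k) ^+ 2.
Proof.
have -> : Gamma R F n ^+ 2 = Gamma R F n *m Gamma R F n by rewrite expr2.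
rewrite /qform -!mulmxA dot_blocks; apply: eq_bigr => k _.
rewrite norm2_sqr mulr_sumr !block_Gamma.
by apply: eq_bigr => i _; rewrite !mxE; ring.
Qed.

Lemma affine_gt0_between (R : realFieldType) (p q f x : R) :
  - f <= x -> x <= f -> 0 < p + f * q -> 0 < p - f * q -> 0 < p + x * q.
Proof.
move=> lx xu hp hm; case: (leP 0 q) => hq.
  have : - f * q <= x * q by rewrite ler_wpM2r.
  by lra.
have : f * q <= x * q by rewrite ler_wnM2r // ltW.
by lra.
Qed.

(** Positivity of the determinant of the moments is not just Cauchy-Schwarz:
    it excludes the equality case, a vector supported on a single level.  The
    identity a g(l) = (a c - b^2) + (b - M a) (b - l a) gives it directly from
    the positivity of g at the extreme levels. *)
Lemma moment_det_gt0 (R : realFieldType) (a b c M f : R) :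
  0 < a -> - (f * a) <= b -> b <= f * a ->
  0 < c - (M + f) * b + M * f * a -> 0 < c - (M - f) * b - M * f * a ->
  0 < a * c - b ^+ 2.
Proof.
move=> a0 lb ub hp hm; rewrite ltNge; apply/negP => D0.
have {}hp : 0 < (b - M * a) * (b - f * a).
  by have := mulr_gt0 a0 hp; rewrite expr2 in D0; lra.
have {}hm : 0 < (b - M * a) * (b + f * a).
  by have := mulr_gt0 a0 hm; rewrite expr2 in D0; lra.
case: (leP 0 (b - M * a)) => h.
  have : (b - M * a) * (b - f * a) <= 0 by rewrite mulr_ge0_le0 // subr_le0.
  by lra.
have : (b - M * a) * (b + f * a) <= 0.
  by rewrite mulr_le0_ge0 ?(ltW h) //; lra.
by lra.
Qed.

Lemma moments_of_S (R : realType) (F n : nat) (M : R) (w : bvec R F n) :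
  S_set F n M w ->
  let a := dotself w in
  let b := qform (Gamma R F n) w in
  let c := qform (Gamma R F n ^+ 2) w in
  0 < a * c - b ^+ 2 /\
  forall k : 'I_(2 * F + 1),
    0 < c - (M + (level k)%:~R) * b + M * (level k)%:~R * a.
Proof.
move=> hw a b c.
have := hw (- F%:Z) (or_intror erefl); have := hw F%:Z (or_introl erefl).
rewrite -/a -/b -/c rmorphN /= -!pmulrn => gF gNF.
have nn k : 0 <= norm2 (block w k) ^+ 2 by exact: sqr_ge0.
have a0 : 0 <= a by rewrite /a dotself_moment sumr_ge0.
have lb : - (F%:R * a) <= b.
  rewrite /a /b dotself_moment qform_Gamma_moment -mulNr mulr_sumr.
  by apply: ler_sum => k _; rewrite ler_wpM2r //; case: (level_bound R k).
have ub : b <= F%:R * a.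
  rewrite /a /b dotself_moment qform_Gamma_moment mulr_sumr.
  by apply: ler_sum => k _; rewrite ler_wpM2r //; case: (level_bound R k).
have cub : c <= F%:R ^+ 2 * a.
  rewrite /a /c dotself_moment qform_Gamma2_moment mulr_sumr.
  apply: ler_sum => k _; rewrite ler_wpM2r //.
  case: (level_bound R k) => lk uk.
  by rewrite -real_normK ?num_real // lerXn2r ?nnegrE // ler_norml lk uk.
(* a = 0 would force b = c = 0, hence g = 0. *)
have {}a0 : 0 < a.
  rewrite lt_neqAle a0 andbT eq_sym; apply/eqP => az.
  move: lb ub cub gF; rewrite az !mulr0 oppr0 => lb ub cub.
  have -> : b = 0 by apply/le_anti; rewrite lb ub.
  by rewrite mulr0; lra.
split.
  by apply: (@moment_det_gt0 _ a b c M F%:R) => //; lra.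
move=> k; case: (level_bound R k) => lk uk.
have := @affine_gt0_between _ (c - M * b) (M * a - b) _ _ lk uk.
have -> : c - (M + (level k)%:~R) * b + M * (level k)%:~R * a
          = c - M * b + (level k)%:~R * (M * a - b) by ring.
by apply; lra.
Qed.

(** Positivity of the coefficients is what allows the squared roots to be
    replaced by the affine expressions under them, making the constraints
    linear in (mu, lambda). *)
Lemma is_multiplier_linear (R : realType) (F n : nat) (M : R) (w : bvec R F n)
    (mu lambda : R) :
  let a := dotself w in
  let b := qform (Gamma R F n) w in
  let c := qform (Gamma R F n ^+ 2) w in
  is_multiplier M w (mu, lambda) <->
  [/\ forall k : 'I_(2 * F + 1), 0 < 1 + 2 * mu + 2 * (level k)%:~R * lambda,
      (1 + 2 * mu) * a + 2 * lambda * b = 1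
    & (1 + 2 * mu) * b + 2 * lambda * c = M].
Proof.
move=> a b c; rewrite /is_multiplier /= /sigma.
have sumsE : (forall k : 'I_(2 * F + 1),
    0 < 1 + 2 * mu + 2 * (level k)%:~R * lambda) ->
  \sum_(k < 2 * F + 1) norm2 (block w k) ^+ 2
     * Num.sqrt (1 + 2 * mu + 2 * (level k)%:~R * lambda) ^+ 2
    = (1 + 2 * mu) * a + 2 * lambda * b /\
  \sum_(k < 2 * F + 1) (level k)%:~R * norm2 (block w k) ^+ 2
     * Num.sqrt (1 + 2 * mu + 2 * (level k)%:~R * lambda) ^+ 2
    = (1 + 2 * mu) * b + 2 * lambda * c.
  move=> pos; rewrite /a /b /c dotself_moment qform_Gamma_moment.
  rewrite qform_Gamma2_moment !mulr_sumr -!big_split /=.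
  by split; apply: eq_bigr => k _; rewrite sqr_sqrtr ?ltW //; ring.
split=> [[pos e1 e2]|[pos e1 e2]].
  have pos' (k : 'I_(2 * F + 1)) : 0 < 1 + 2 * mu + 2 * (level k)%:~R * lambda.
    by move: (pos k); rewrite sqrtr_gt0.
  by have [<- <-] := sumsE pos'; split.
have [-> ->] := sumsE pos.
by split=> // k; rewrite sqrtr_gt0.
Qed.

Theorem lemma6p6 (R : realType) (F n : nat) (M : R)
    (hF : (1 <= F)%N) (hn : (0 < n)%N) (hn_even : ~~ odd n)
    (hM0 : 0 <= M) (hMF : M < F%:R) (hMZ : M \isn't a Num.int)
    (w : 'cV[R]_(\sum_(k < 2 * F + 1) (2 * n))%N) (hw : S_set F n M w) :
  (exists! p : R * R, is_multiplier M w p) /\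
  forall k : 'I_(2 * F + 1),
    block (psi M w) k =
      Num.sqrt
        ((qform (Gamma R F n ^+ 2) w
            - (M + (level k)%:~R) * qform (Gamma R F n) w
            + M * (level k)%:~R * dotself w)
         / (dotself w * qform (Gamma R F n ^+ 2) w
            - qform (Gamma R F n) w ^+ 2))
      *: block w k.
Proof.
have [D0 g0] := moments_of_S hw.
set a := dotself w in D0 g0 *; set b := qform (Gamma R F n) w in D0 g0 *.
set c := qform (Gamma R F n ^+ 2) w in D0 g0 *.
set D := a * c - b ^+ 2 in D0 *.
have Dn : D != 0 by rewrite gt_eqF.
(* Cramer's rule for the unknowns 1 + 2 mu and 2 lambda. *)
pose p0 : R * R := (((c - M * b) / D - 1) / 2, (M * a - b) / D / 2).
have radicandE (l : R) : 1 + 2 * p0.1 + 2 * l * p0.2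
    = (c - (M + l) * b + M * l * a) / D.
  by rewrite /p0 /=; field.
have p0P : is_multiplier M w p0.
  apply/is_multiplier_linear; split=> [k||].
  - by rewrite radicandE divr_gt0.
  - by rewrite -/a -/b /D; field.
  - by rewrite -/b -/c /D; field.
have p0_uniq p : is_multiplier M w p -> p = p0.
  case: p => mu la /is_multiplier_linear[_]; rewrite -/a -/b -/c => e1 e2.
  have s : (1 + 2 * mu) * D = c - M * b.
    transitivity (((1 + 2 * mu) * a + 2 * la * b) * c
                  - ((1 + 2 * mu) * b + 2 * la * c) * b).
      by rewrite /D; ring.
    by rewrite e1 e2 mul1r.
  have t : 2 * la * D = M * a - b.
    transitivity (((1 + 2 * mu) * b + 2 * la * c) * a
                  - ((1 + 2 * mu) * a + 2 * la * b) * b).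
      by rewrite /D; ring.
    by rewrite e1 e2 mul1r.
  by rewrite /p0 -s -t !mulfK //; congr pair; field.
have -> : psi M w = \mxcol_(k < 2 * F + 1)
    (sigma p0.1 p0.2 (level k) *: block w k).
  have -> // : p0 = multiplier M w.
  by apply/esym/p0_uniq; apply: (@xgetPex _ (0, 0) _ (ex_intro _ p0 p0P)).
split; first by exists p0; split=> // p /p0_uniq.
by move=> k; rewrite {1}/block mxcolK /sigma radicandE.
Qed.
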